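(* Let $G$ be a finite group such that $(G,Z(G))$ is a generalized Camina pair, and let $g\in G'$. Then $$\zeta^{w_2}_G(g)=\begin{cases}\frac{|G|^2}{|G'|}\left(1-\frac1{|G:Z(G)|}\right) & \text{if } g\ne 1,\\[2pt] \frac{|G|^2}{|G'|}\left(1+\frac{|G'|-1}{|G:Z(G)|}\right) & \text{if } g=1,\end{cases}$$ and, if $n\ge 3$, $$\zeta^{w_n}_G(g)=\begin{cases}0 & \text{if } g\neq 1,\\ |G|^n & \text{if } g=1.\end{cases}$$
   Context: $[a,b]=a^{-1}b^{-1}ab$; $w_2(x_1,x_2)=[x_1,x_2]$ and $w_n(x_1,\dots,x_n)=[w_{n-1}(x_1,\dots,x_{n-1}),x_n]$ for $n\ge3$. $\zeta^{w_n}_G(g)=|\{(a_1,\dots,a_n)\in G^n : w_n(a_1,\dots,a_n)=g\}|$. $Z(G)$ is the center and $G'=[G,G]$ the commutator subgroup. For a normal subgroup $N$ of $G$, the pair $(G,N)$ is a generalized Camina pair (GCP) if $\chi(g)=0$ for every nonlinear irreducible complex character $\chi$ of $G$ and every $g\in G\setminus N$. *)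

(* Defs.v *)
From mathcomp Require Import all_boot all_fingroup all_algebra all_solvable.
From mathcomp Require Import all_field all_character.

Set Implicit Arguments.
Unset Strict Implicit.
Unset Printing Implicit Defensive.

Import GroupScope.

Section Defs.

Variable gT : finGroupType.

(* w_n(x_1, ..., x_n) = [.. [[x_1, x_2], x_3] .., x_n]; the library's [~ x, y]
   is x^-1 * y^-1 * x * y.  The values for n = 0 and n = 1 (namely 1 and x_1)
   are conventions. *)
Definition lcomm_word (s : seq gT) : gT :=
  foldl (fun u x => [~ u, x]) (head 1 s) (behead s).

Definition zeta_lcomm (G : {group gT}) (n : nat) (g : gT) : nat :=
  #|[set t : n.-tuple gT | all (mem G) t & lcomm_word t == g]|.

(* Characters take values in algC, which contains all values of complex
   characters of finite groups. *)
Definition gen_camina_pair (G N : {group gT}) : Prop :=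
  N <| G /\
  forall chi : 'CF(G), chi \in irr G -> chi \isn't a linear_char ->
  forall g : gT, g \in G :\: N -> chi g = 0%R.

End Defs.

(* Main.v *)
Require Import Defs.
From mathcomp Require Import all_boot all_fingroup all_algebra all_solvable.
From mathcomp Require Import all_field all_character.
From mathcomp Require Import ring.

(* If (G, N) is a generalized Camina pair and x lies in G \ N, only linear
   characters contribute to column orthogonality at x, so |C_G(x)| = |G : G'|
   and the class of x is the whole coset x G'.  For N = Z(G) this forces
   G' <= Z(G), because the class of a noncentral x in G' would be G' and so
   contain 1.  A noncentral a then satisfies [a, b] = g, that is a ^ b = a g,
   for exactly |G : G'| elements b, whatever g in G'. *)

Import GRing.Theory Num.Theory.

Lemma card_tuples_all (T : finType) (A : {set T}) n :
  #|[set t : n.-tuple T | all (mem A) t]| = (#|A| ^ n)%N.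
Proof.
pose f (t : n.-tuple T) : {ffun 'I_n -> T} := [ffun i => tnth t i].
have f_bij : bijective f.
  exists (fun h : {ffun 'I_n -> T} => [tuple h i | i < n]) => [t | h].
    by apply: eq_from_tnth => i; rewrite tnth_mktuple ffunE.
  by apply/ffunP=> i; rewrite ffunE tnth_mktuple.
rewrite -[n in RHS]card_ord -(card_ffun_on 'I_n A) -cardsE.
rewrite -(on_card_preimset (onW_bij _ f_bij)); apply: eq_card => t.
rewrite !inE; apply/idP/forallP => [/all_tnthP At i | At].
  by rewrite ffunE; apply: At.
by apply/all_tnthP=> i; move: (At i); rewrite ffunE inE.
Qed.

Section GeneralizedCaminaPair.

Set Implicit Arguments.
Unset Strict Implicit.
Import GroupScope.

Variables (gT : finGroupType) (G : {group gT}).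
Implicit Types (N : {group gT}) (x a g : gT).

Lemma gcp_card_cent1 N x :
  gen_camina_pair G N -> x \in G :\: N -> #|'C_G[x]| = #|G : G^`(1)|.
Proof.
move=> [_ chi0] GNx; have Gx : x \in G by case/setDP: GNx.
apply/eqP; rewrite -(eqr_nat algC); apply/eqP.
have := second_orthogonality_relation x Gx.
rewrite class_refl mulr1n => <-.
rewrite -card_lin_irr -sum1_card natr_sum [RHS]big_mkcond /=.
apply: eq_bigr => i _; case: ifP => [lin_i | nlin_i].
  by rewrite -normCK (normC_lin_char lin_i Gx) expr1n.
rewrite inE in nlin_i.
by rewrite (chi0 ('chi_i)%R) ?mem_irr ?mul0r ?nlin_i.
Qed.

Lemma gcp_class N x :
  gen_camina_pair G N -> x \in G :\: N -> x ^: G = x *: G^`(1).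
Proof.
move=> gcpN GNx; have Gx : x \in G by case/setDP: GNx.
have sG'G := der_sub 1 G.
apply/eqP; rewrite eqEcard card_lcoset; apply/andP; split.
  apply/subsetP=> _ /imsetP[b Gb ->].
  by rewrite mem_lcoset -commgEl mem_commg.
rewrite -index_cent1 -(@leq_pmul2r #|'C_G[x]|) ?cardG_gt0 //.
rewrite {1}(gcp_card_cent1 gcpN GNx) (Lagrange sG'G).
by rewrite mulnC Lagrange ?subsetIl.
Qed.

Lemma gcp_center_der1 : gen_camina_pair G 'Z(G)%G -> G^`(1) \subset 'Z(G).
Proof.
(* The contradiction is with [1 \in 'Z(G)]: a noncentral [x] in the derived subgroup would be
   conjugate to [1], hence equal to it. *)
move=> gcpZ; apply/subsetP=> x G'x; apply: contraLR (group1 'Z(G)) => nZx.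
have GZx : x \in G :\: 'Z(G) by rewrite inE nZx (subsetP (der_sub 1 G)).
have : 1 \in x ^: G by rewrite (gcp_class gcpZ GZx) mem_lcoset mulg1 groupV.
case/imsetP=> b _; rewrite -(conj1g b) => /conjg_inj x1.
by rewrite -x1 group1 in nZx.
Qed.

(** The equation means [a ^ b = a * g]. Its solutions in [G] form a right coset of ['C_G[a]] if
    [a * g] is conjugate to [a], and there are none otherwise. *)
Lemma card_commg_fibre a g :
  #|[set b in G | [~ a, b] == g]| = (((a * g)%g \in a ^: G) * #|'C_G[a]|)%N.
Proof.
have fibreE b : ([~ a, b] == g) = (a ^ b == a * g).
  by rewrite commgEl -(inj_eq (mulgI a)) mulKVg.
case: imsetP => [[h Gh agE] | no_h]; last first.
  apply: eq_card0 => b; rewrite inE fibreE; apply/andP=> -[Gb /eqP eq_b].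
  by apply: no_h; exists b.
(* Any one solution [h] represents the coset: [b] is a solution iff [b * h^-1] centralizes [a]. *)
rewrite mul1n -(card_rcoset 'C_G[a] h); apply: eq_card => b.
rewrite mem_rcoset in_setI inE fibreE agE groupMr ?groupV //; congr (_ && _).
rewrite cent1C (sameP cent1P commgP) -conjg_fix conjgM.
by rewrite (can2_eq (conjgKV h) (conjgK h)).
Qed.

Lemma zeta_lcomm2 g :
  zeta_lcomm G 2 g = (\sum_(a in G) #|[set b in G | [~ a, b] == g]|)%N.
Proof.
pose f (p : gT * gT) := [tuple p.1; p.2].
have f_inj : injective f by move=> [a b] [c d] /(congr1 val)[-> ->].
under eq_bigr => a _ do rewrite -sum1_card.
rewrite pair_big_dep sum1_card /zeta_lcomm -(card_imset _ f_inj) /=.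
apply: eq_card => t; rewrite inE; apply/idP/imsetP => [|[[a b]]].
  case/tupleP: t => a t; case/tupleP: t => b t; rewrite tuple0 /= andbT.
  case/andP=> /andP[Ga Gb] /eqP gE; exists (a, b); last exact: val_inj.
  by rewrite unfold_in /= inE Ga Gb -gE /lcomm_word /= eqxx.
by rewrite unfold_in /= inE => /and3P[Ga Gb gE] ->; rewrite /= Ga Gb.
Qed.

Lemma zeta_lcomm2_gcp_center g :
    gen_camina_pair G 'Z(G)%G -> g \in G^`(1) ->
  zeta_lcomm G 2 g =
    ((g == 1%g) * (#|'Z(G)| * #|G|) + (#|G| - #|'Z(G)|) * #|G : G^`(1)|)%N.
Proof.
move=> gcpZ G'g; rewrite zeta_lcomm2 (big_setID 'Z(G)) /=.
rewrite (setIidPr (center_sub G)); congr (_ + _)%N.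
  rewrite mulnCA -sum_nat_const; apply: eq_bigr => a Za.
  have commg_a b : b \in G -> [~ a, b] = 1.
    by case/centerP: Za => _ cGa /cGa/commgP/eqP.
  have [-> | g_neq1] := eqVneq g 1.
    rewrite mul1n; apply: eq_card => b; rewrite inE.
    by case: (boolP (b \in G)) => //= /commg_a->; rewrite eqxx.
  rewrite mul0n; apply: eq_card0 => b; rewrite inE; apply/andP=> -[/commg_a->].
  by rewrite eq_sym (negPf g_neq1).
rewrite -(cardsDS (center_sub G)) -sum_nat_const; apply: eq_bigr => a GZa.
rewrite card_commg_fibre (gcp_class gcpZ GZa) (gcp_card_cent1 gcpZ GZa).
by rewrite mem_lcoset mulKg G'g mul1n.
Qed.

Lemma foldl_commg1 (s : seq gT) : foldl (fun u x => [~ u, x]) 1 s = 1.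
Proof. by elim: s => //= x s; rewrite comm1g. Qed.

(** The first commutator is central, so the third entry makes the word trivial, and it stays trivial
    from there on. *)
Lemma lcomm_word_nil2 (s : seq gT) :
    G^`(1) \subset 'Z(G) -> 2 < size s -> all (mem G) s -> lcomm_word s = 1.
Proof.
move=> sG'Z; case: s => [|a [|b [|c s]]] //= _ /and4P[Ga Gb Gc _].
have /centerP[_ cab] : [~ a, b] \in 'Z(G) by rewrite (subsetP sG'Z) ?mem_commg.
by have /commgP/eqP abc1 := cab c Gc; rewrite /lcomm_word /= abc1 foldl_commg1.
Qed.

End GeneralizedCaminaPair.

Local Open Scope ring_scope.

Theorem theorem3p4 (gT : finGroupType) (G : {group gT}) (g : gT)
    (hGCP : gen_camina_pair G 'Z(G)%G) (hg : g \in G^`(1)%g) :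
  (zeta_lcomm G 2 g)%:R =
    (if g != 1%g
     then #|G|%:R ^+ 2 / #|G^`(1)%g|%:R * (1 - 1 / #|G : 'Z(G)|%g%:R)
     else #|G|%:R ^+ 2 / #|G^`(1)%g|%:R *
            (1 + (#|G^`(1)%g|%:R - 1) / #|G : 'Z(G)|%g%:R)) :> rat
  /\
  (forall n : nat, (3 <= n)%N ->
     zeta_lcomm G n g = if g != 1%g then 0%N else (#|G| ^ n)%N).

Proof.
split=> [|n n_gt2].
  rewrite zeta_lcomm2_gcp_center //.
  have sZG := center_sub G; have sG'G := der_sub 1 G.
  have oZ : (#|G|%g%:R = #|'Z(G)|%g%:R * #|G : 'Z(G)|%g%:R :> rat).
    by rewrite -natrM Lagrange.
  have oG' : (#|G|%g%:R = #|G^`(1)|%g%:R * #|G : G^`(1)|%g%:R :> rat).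
    by rewrite -natrM Lagrange.
  have Z_neq0 : (#|G : 'Z(G)|%g%:R != 0 :> rat) by rewrite pnatr_eq0 -lt0n.
  have G'_neq0 : (#|G^`(1)|%g%:R != 0 :> rat) by rewrite pnatr_eq0 -lt0n.
  (* The truncated subtraction casts correctly because [#|'Z(G)| <= #|G|]. *)
  rewrite natrD !natrM natrB ?subset_leq_card //.
  have -> : (#|G : G^`(1)|%g%:R = #|G|%g%:R / #|G^`(1)|%g%:R :> rat).
    by rewrite oG' mulrAC mulfV ?mul1r.
  rewrite oZ; case: eqP => _ /=; field; exact/andP.
have sG'Z := gcp_center_der1 hGCP.
(* The word is constant on [G], so the fibre is either all tuples over [G] or empty. *)
have word1 (t : n.-tuple gT) : all (mem G) t -> lcomm_word t = 1%g.
  by apply: lcomm_word_nil2; rewrite ?size_tuple.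
case: eqP => [-> | /eqP g_neq1] /=.
  rewrite -card_tuples_all; apply: eq_card => t; rewrite !inE.
  by case: (boolP (all _ t)) => //= /word1->; rewrite eqxx.
apply: eq_card0 => t; rewrite !inE; apply/andP=> -[/word1-> /eqP g1].
by rewrite -g1 eqxx in g_neq1.
Qed.
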